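(* Let $S=\begin{bmatrix} S_{11} & S_{12}\\ S_{21} & S_{22}\end{bmatrix}$ be an arbitrary real $2n\times 2n$ matrix with $n\times n$ blocks $S_{ij}$. Put $S^{(0)}=S$ and, for $i=1,\ldots,n-1$, let $U_i=\begin{bmatrix} Q_i & 0\\ Y_iQ_i & Q_i\end{bmatrix}$ be the matrix constructed from $S^{(i-1)}$ as described in the context and $S^{(i)}=U_i^{-1}S^{(i-1)}U_i$. Assume that at every step $i=1,\ldots,n-1$ the number $\beta$ of the construction is finite (i.e. $s^2+r_{i+1,i}s\neq 0$), and that $Y_i$ is well defined, i.e. either the $i$-th column of the $(2,1)$ block of $S^{(i-1)}$ is already upper triangular or $\sum_{j=i+1}^n t_{ji}r_{ji}\ne 0$, where $r_{jk}$ and $t_{jk}$ denote the entries of the $(1,1)$ block and of the $(2,1)$ block of $S^{(i-1)}$, respectively. Then the global transformation matrix $U=U_1U_2\cdots U_{n-1}$ has the form $$U=\begin{bmatrix} Q & 0\\ YQ & Q\end{bmatrix},\qquad Q^{\mathrm T}Q=I,\quad Y^{\mathrm T}=Y,$$ where the first row and the first column of $Y$ are equal to zero, and the transformed matrix $S'=U^{-1}SU=\begin{bmatrix} S'_{11} & S'_{12}\\ S'_{21} & S'_{22}\end{bmatrix}$ is such that $S'_{11}$ is an upper Hessenberg matrix and $S'_{21}$ is an upper triangular matrix.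
   Context: All matrices are real. The $i$-th column of an $n\times n$ matrix $(a_{jk})$ is called upper triangular if $a_{ji}=0$ for $j>i$, and Hessenberg if $a_{ji}=0$ for $j>i+1$; a matrix is upper triangular (upper Hessenberg) if all its columns are. Construction of $U_i=\begin{bmatrix} Q_i & 0\\ Y_iQ_i & Q_i\end{bmatrix}$ from $S^{(i-1)}$ (step $i$, $1\le i\le n-1$). Write $r_{jk}$ for the entries of the $(1,1)$ block and $t_{jk}$ for the entries of the $(2,1)$ block of $S^{(i-1)}$. (1) If the $i$-th column of the $(2,1)$ block is already upper triangular, $Y_i=0$. Otherwise $Y_i=\alpha\, v v^{\mathrm T}$, with $v=(0,\ldots,0,t_{i+1,i},\ldots,t_{n,i})^{\mathrm T}$ (first $i$ entries zero) and $\alpha=1/\sum_{j=i+1}^n t_{ji}r_{ji}$, the denominator being assumed nonzero. (2) $Q_i=I_n-2ww^{\mathrm T}$, where $w=(0,\ldots,0,w_{i+1},\ldots,w_n)^{\mathrm T}$ (first $i$ entries zero) with $$w_{i+1}=\beta\,(r_{i+1,i}+s),\qquad w_j=\beta\, r_{ji}\ \ (j=i+2,\ldots,n),$$ $$s=\left[r_{i+1,i}^2+r_{i+2,i}^2+\cdots+r_{n,i}^2\right]^{1/2},\qquad \beta=\left[2\,(s^2+r_{i+1,i}\,s)\right]^{-1/2}.$$ *)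

(* Defs.v *)
From mathcomp Require Import all_boot all_order all_algebra.

Set Implicit Arguments.
Unset Strict Implicit.
Unset Printing Implicit Defensive.

Import Order.TTheory GRing.Theory Num.Theory.
Local Open Scope ring_scope.

(* Square matrices have positive size n.+1 and all indices start from 0. *)

Definition upper_triangular_col (R : rcfType) (n : nat)
    (A : 'M[R]_n.+1) (i : 'I_n.+1) : bool :=
  [forall j : 'I_n.+1, (i < j)%N ==> (A j i == 0)].

Definition hessenberg_col (R : rcfType) (n : nat)
    (A : 'M[R]_n.+1) (i : 'I_n.+1) : bool :=
  [forall j : 'I_n.+1, (i.+1 < j)%N ==> (A j i == 0)].

Definition upper_triangular (R : rcfType) (n : nat) (A : 'M[R]_n.+1) : bool :=
  [forall i, upper_triangular_col A i].

Definition upper_hessenberg (R : rcfType) (n : nat) (A : 'M[R]_n.+1) : bool :=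
  [forall i, hessenberg_col A i].

Definition shear_den (R : rcfType) (n : nat)
    (A T : 'M[R]_n.+1) (i : 'I_n.+1) : R :=
  \sum_(j < n.+1 | (i < j)%N) T j i * A j i.

Definition shear_vec (R : rcfType) (n : nat)
    (T : 'M[R]_n.+1) (i : 'I_n.+1) : 'cV[R]_n.+1 :=
  \col_(j < n.+1) (if (i < j)%N then T j i else 0).

Definition shear_Y (R : rcfType) (n : nat)
    (A T : 'M[R]_n.+1) (i : 'I_n.+1) : 'M[R]_n.+1 :=
  if upper_triangular_col T i then 0
  else (shear_den A T i)^-1 *: (shear_vec T i *m (shear_vec T i)^T).

Definition house_s (R : rcfType) (n : nat)
    (A : 'M[R]_n.+1) (i : 'I_n.+1) : R :=
  Num.sqrt (\sum_(j < n.+1 | (i < j)%N) A j i ^+ 2).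

(* The row index inord i.+1 is the intended one only when i is not the last
   index; the last column is never treated. *)
Definition house_den (R : rcfType) (n : nat)
    (A : 'M[R]_n.+1) (i : 'I_n.+1) : R :=
  house_s A i ^+ 2 + A (inord i.+1) i * house_s A i.

Definition house_beta (R : rcfType) (n : nat)
    (A : 'M[R]_n.+1) (i : 'I_n.+1) : R :=
  (Num.sqrt (2 * house_den A i))^-1.

Definition house_vec (R : rcfType) (n : nat)
    (A : 'M[R]_n.+1) (i : 'I_n.+1) : 'cV[R]_n.+1 :=
  \col_(j < n.+1)
    (if (j <= i)%N then 0
     else if j == i.+1 :> nat then house_beta A i * (A j i + house_s A i)
     else house_beta A i * A j i).

Definition house_Q (R : rcfType) (n : nat)
    (A : 'M[R]_n.+1) (i : 'I_n.+1) : 'M[R]_n.+1 :=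
  1%:M - 2 *: (house_vec A i *m (house_vec A i)^T).

Definition step_mx (R : rcfType) (n : nat)
    (S : 'M[R]_(n.+1 + n.+1)) (i : 'I_n.+1) : 'M[R]_(n.+1 + n.+1) :=
  let Q := house_Q (ulsubmx S) i in
  let Y := shear_Y (ulsubmx S) (dlsubmx S) i in
  block_mx Q 0 (Y *m Q) Q.

(* iter_S S k is S^(k): the step from S^(k) to S^(k+1), for k < n, treats the
   column of 0-based index k. *)
Fixpoint iter_S (R : rcfType) (n : nat)
    (S : 'M[R]_(n.+1 + n.+1)) (k : nat) : 'M[R]_(n.+1 + n.+1) :=
  if k is k'.+1 then
    let Sk := iter_S S k' in
    let U := step_mx Sk (inord k') in
    invmx U *m Sk *m U
  else S.

(* iter_U S k is U_(k+1). *)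
Definition iter_U (R : rcfType) (n : nat)
    (S : 'M[R]_(n.+1 + n.+1)) (k : nat) : 'M[R]_(n.+1 + n.+1) :=
  step_mx (iter_S S k) (inord k).

(* The ordered product U_1 U_2 ... U_n. *)
Definition global_U (R : rcfType) (n : nat)
    (S : 'M[R]_(n.+1 + n.+1)) : 'M[R]_(n.+1 + n.+1) :=
  \big[mulmx/1%:M]_(k < n) iter_U S k.

(* Main.v *)
Require Import Defs.
From mathcomp Require Import all_boot all_order all_algebra.
From mathcomp Require Import ring.

Set Implicit Arguments.
Unset Strict Implicit.
Unset Printing Implicit Defensive.

Import Order.TTheory GRing.Theory Num.Theory.
Local Open Scope ring_scope.

(** The argument rests on one notion: a vector supported in the rows up to [i].
    The vectors [v] and [w] that define the shear and the reflection treating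
    column [i] vanish in these rows, so [Y_i = alpha v v^T] annihilates
    such a vector and [Q_i = I - 2 w w^T] fixes it ([shear_Y_supp],
    [house_Q_supp]).  In particular both act trivially on the basis vectors
    [e_j], [j <= i], so that for these [j] the columns [a_j] and [t_j] of the
    (1,1) and (2,1) blocks become [Q_i a_j] and [Q_i (t_j - Y_i a_j)], and the
    blocks on the right do not interfere ([shear_rot_conj]).

    For [j < i] the column [a_j], already Hessenberg, lives in the rows up to
    [j+1 <= i], and [t_j] in the rows up to [j]: the step leaves both unchanged.
    For [j = i], unless [t_i] is already triangular, the scalar [alpha] is such
    that [Y_i a_i = v], so [t_i - Y_i a_i] is [t_i] cut below row [i], which
    [Q_i] then fixes; and [Q_i] reflects [a_i] onto a vector supported in the rows up to
    [i+1] ([house_reduces]).  Hence every step reduces one more column of both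
    blocks and preserves the earlier ones ([step_reduces]).

    As to the shape of [U], with [T(Q, Y)] the block matrix with rows [(Q, 0)]
    and [(Y Q, Q)], orthogonality of [P] gives
    [T(P, X) T(Q, Y) = T(P Q, X + P Y P^T)], so orthogonality of [Q] and symmetry
    of [Y] survive products.  Every step also satisfies [Q e_0 = e_0] and
    [Y e_0 = 0], and these two conditions together survive as well; by symmetry
    the second one kills both the first row and the first column of [Y]. *)

(** * Products and inverses of rotated shears *)

Lemma invmx_eq (R : comUnitRingType) (n : nat) (A B : 'M[R]_n) :
  A *m B = 1%:M -> invmx A = B.
Proof.
by move=> AB1; have [uA _] := mulmx1_unit AB1; rewrite -(mulKmx uA B) AB1 mulmx1.
Qed.

Lemma invmxM (R : comUnitRingType) (n : nat) (A B : 'M[R]_n) :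
  A \in unitmx -> B \in unitmx -> invmx (A *m B) = invmx B *m invmx A.
Proof.
by move=> uA uB; apply: invmx_eq; rewrite mulmxA mulmxK // mulmxV.
Qed.

Definition shear_rot (R : rcfType) (n : nat) (Q Y : 'M[R]_n) : 'M[R]_(n + n) :=
  block_mx Q 0 (Y *m Q) Q.

Lemma shear_rotV (R : rcfType) (n : nat) (Q Y : 'M[R]_n) :
  Q^T *m Q = 1%:M ->
  shear_rot Q Y *m block_mx Q^T 0 (- (Q^T *m Y)) Q^T = 1%:M.
Proof.
move=> /mulmx1C QQt; rewrite /shear_rot mulmx_block !mul0mx !mulmx0 !addr0 add0r.
by rewrite QQt mulmxN mulmxA QQt mul1mx -mulmxA QQt mulmx1 subrr -scalar_mx_block.
Qed.

(** Moving the shear of the second factor across the rotation [P] of the first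
    one conjugates it by [P]; this keeps it symmetric. *)
Lemma shear_rotM (R : rcfType) (n : nat) (P X Q Y : 'M[R]_n) :
  P^T *m P = 1%:M ->
  shear_rot P X *m shear_rot Q Y = shear_rot (P *m Q) (X + P *m Y *m P^T).
Proof.
move=> PtP; rewrite /shear_rot mulmx_block !mul0mx !mulmx0 !addr0 add0r.
by congr block_mx; rewrite mulmxDl !mulmxA -(mulmxA _ P^T P) PtP mulmx1.
Qed.

(** On a vector [e] fixed by [Q] and killed by [Y], the transformation itself
    acts as the embedding of [e] in the upper half, so the right blocks of [S]
    never enter. *)
Lemma shear_rot_conj (R : rcfType) (n : nat) (Q Y : 'M[R]_n)
    (S : 'M[R]_(n + n)) (e : 'cV[R]_n) :
  Q^T *m Q = 1%:M -> Q *m e = e -> Y *m e = 0 ->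
  let S' := invmx (shear_rot Q Y) *m S *m shear_rot Q Y in
  ulsubmx S' *m e = Q^T *m (ulsubmx S *m e) /\
  dlsubmx S' *m e = Q^T *m (dlsubmx S *m e - Y *m (ulsubmx S *m e)).
Proof.
move=> QtQ Qe Ye /=; rewrite (invmx_eq (shear_rotV Y QtQ)) /shear_rot.
split; rewrite -{1}[S]submxK !mulmx_block ?block_mxKul ?block_mxKdl ?mul0mx ?addr0.
  by rewrite mulmxDl -!mulmxA Qe Ye !mulmx0 addr0.
rewrite mulmxDl -!mulmxA Qe Ye !mulmx0 addr0.
by rewrite mulmxDl !mulNmx mulmxBr addrC !mulmxA.
Qed.

(** * Vectors supported in the leading rows *)

Definition supp_le (R : rcfType) (n : nat) (m : nat) (x : 'cV[R]_n) : Prop :=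
  forall k : 'I_n, (m < k)%N -> x k 0 = 0.

Lemma supp_le_delta (R : rcfType) (n m : nat) (j : 'I_n) :
  (j <= m)%N -> supp_le m (delta_mx j 0 : 'cV[R]_n).
Proof.
by move=> jm k mk; rewrite mxE -val_eqE /= gtn_eqF // (leq_ltn_trans jm).
Qed.

Lemma supp_leW (R : rcfType) (n m m' : nat) (x : 'cV[R]_n) :
  (m <= m')%N -> supp_le m x -> supp_le m' x.
Proof. by move=> mm h k /(leq_ltn_trans mm)/h. Qed.

Lemma upper_triangular_colP (R : rcfType) (n : nat) (A : 'M[R]_n.+1)
    (i : 'I_n.+1) :
  reflect (supp_le i (col i A)) (upper_triangular_col A i).
Proof.
apply: (iffP forallP) => [h k ik|h k]; first by rewrite mxE; apply/eqP/(implyP (h k)).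
by apply/implyP => /h; rewrite mxE => ->.
Qed.

Lemma hessenberg_colP (R : rcfType) (n : nat) (A : 'M[R]_n.+1)
    (i : 'I_n.+1) :
  reflect (supp_le i.+1 (col i A)) (hessenberg_col A i).
Proof.
apply: (iffP forallP) => [h k ik|h k]; first by rewrite mxE; apply/eqP/(implyP (h k)).
by apply/implyP => /h; rewrite mxE => ->.
Qed.

(** * The shear and the reflection of one step *)

Section Step.
Variables (R : rcfType) (n : nat).
Implicit Types (A T : 'M[R]_n.+1) (i : 'I_n.+1) (x : 'cV[R]_n.+1).

Lemma shear_vec_dot T i x :
  (shear_vec T i)^T *m x = (\sum_(j < n.+1 | (i < j)%N) T j i * x j 0)%:M.
Proof.
apply/matrixP => a b; rewrite !mxE !ord1 eqxx mulr1n [RHS]big_mkcond.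
by apply: eq_bigr => j _; rewrite !mxE; case: ifP; rewrite ?mul0r.
Qed.

Lemma shear_Y_sym A T i : (shear_Y A T i)^T = shear_Y A T i.
Proof.
rewrite /shear_Y; case: ifP => _; first exact: trmx0.
by rewrite linearZ /= trmx_mul trmxK.
Qed.

Lemma shear_Y_supp A T i x : supp_le i x -> shear_Y A T i *m x = 0.
Proof.
move=> xi; rewrite /shear_Y; case: ifP => _; first exact: mul0mx.
suff vx : (shear_vec T i)^T *m x = 0 by rewrite -scalemxAl -mulmxA vx mulmx0 scaler0.
by rewrite shear_vec_dot big1 ?raddf0 // => j /xi ->; rewrite mulr0.
Qed.

(** If [t_i] is not triangular yet, [Y = alpha v v^T] with [alpha] the inverse of
    [v^T a_i], whence [Y a_i = v], the part of [t_i] below the diagonal. *)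
Lemma shear_triangularizes A T i :
  upper_triangular_col T i \/ shear_den A T i != 0 ->
  supp_le i (col i T - shear_Y A T i *m col i A).
Proof.
rewrite /shear_Y; case: ifP => [/upper_triangular_colP Ti _|_ [//|den0]].
  by rewrite mul0mx subr0.
have vA : (shear_vec T i)^T *m col i A = (shear_den A T i)%:M.
  by rewrite shear_vec_dot; congr _%:M; apply: eq_bigr => j _; rewrite mxE.
move=> k ik; rewrite -scalemxAl -mulmxA vA mul_mx_scalar scalerA mulVf // scale1r.
by rewrite !mxE ik subrr.
Qed.

Lemma house_Q_sym A i : (house_Q A i)^T = house_Q A i.
Proof.
by rewrite /house_Q linearB linearZ /= trmx1 trmx_mul trmxK.
Qed.

Lemma house_Q_supp A i x : supp_le i x -> house_Q A i *m x = x.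
Proof.
move=> xi; suff vx : (house_vec A i)^T *m x = 0.
  by rewrite mulmxBl mul1mx -scalemxAl -mulmxA vx mulmx0 scaler0 subr0.
apply/matrixP => a b; rewrite !mxE big1 // => j _; rewrite !mxE (ord1 b).
by case: (leqP j i) => [_|/xi ->]; rewrite ?mulr0 ?mul0r.
Qed.

Section Householder.
Variables (A : 'M[R]_n.+1) (i : 'I_n.+1).
Hypotheses (lt_in : (i < n)%N) (den_neq0 : house_den A i != 0).

Let p : 'I_n.+1 := inord i.+1.
Let pE : p = i.+1 :> nat. Proof. by rewrite inordK. Qed.
Let s := house_s A i.

Lemma house_s_sqr : s ^+ 2 = \sum_(j < n.+1 | (i < j)%N) A j i ^+ 2.
Proof. by rewrite sqr_sqrtr // sumr_ge0 // => j _; exact: sqr_ge0. Qed.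

(** The denominator is [s * (s + a_(i+1,i))], nonnegative since the entry
    [a_(i+1,i)] is one of those whose squares sum to [s^2]; positivity is what
    makes the square root in [beta] a true one. *)
Lemma house_den_gt0 : 0 < house_den A i.
Proof.
rewrite lt_def den_neq0 /house_den -/s -/p expr2 -mulrDl mulr_ge0 ?sqrtr_ge0 //.
have : `|A p i| <= s.
  rewrite -(@ler_pXn2r _ 2) ?nnegrE ?sqrtr_ge0 // house_s_sqr real_normK ?num_real //.
  by rewrite (bigD1 p) ?pE //= lerDl sumr_ge0 // => j _; exact: sqr_ge0.
by rewrite ler_norml -subr_ge0 opprK addrC => /andP[].
Qed.

Lemma house_beta_sqr : house_beta A i ^+ 2 * (2 * house_den A i) = 1.
Proof.
have d0 := house_den_gt0.
rewrite /house_beta exprVn sqr_sqrtr ?mulVf ?mulf_neq0 ?pnatr_eq0 //.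
by rewrite mulr_ge0 ?ler0n // ltW.
Qed.

(** The reflection vector is a multiple of [u + s e_(i+1)], with [u] the part of
    [a_i] below the diagonal: it joins [- s e_(i+1)] to [u], two vectors of the
    same length [s], so the reflection exchanges them. *)
Lemma house_vecE :
  house_vec A i = house_beta A i *: (shear_vec A i + s *: delta_mx p 0).
Proof.
apply/matrixP => j b; rewrite !mxE !ord1 eqxx andbT -val_eqE /= pE -/s.
case: (ltngtP j i.+1) => [||->]; rewrite ?ltnS ?ltnn ?leqnn.
- by move=> ->; rewrite mulr0 addr0 mulr0.
- by move=> ij; rewrite leqNgt (ltnW ij) /= mulr0 addr0.
- by rewrite mulr1.
Qed.

Lemma delta_dot x : (delta_mx p 0)^T *m x = (x p 0)%:M.
Proof.
rewrite trmx_delta -rowE; apply/matrixP => a b.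
by rewrite !mxE !ord1 eqxx.
Qed.

Lemma house_vec_dot x :
  (house_vec A i)^T *m x = (house_beta A i *
     (\sum_(j < n.+1 | (i < j)%N) A j i * x j 0 + s * x p 0))%:M.
Proof.
rewrite house_vecE linearZ /= -scalemxAl linearD linearZ /= mulmxDl -scalemxAl.
by rewrite shear_vec_dot delta_dot scale_scalar_mx -raddfD scale_scalar_mx.
Qed.

Lemma house_vec_dot_col :
  (house_vec A i)^T *m col i A = (house_beta A i * house_den A i)%:M.
Proof.
rewrite house_vec_dot /house_den -/s house_s_sqr mxE (mulrC s).
by congr (_ * (_ + _))%:M; apply: eq_bigr => j _; rewrite mxE expr2.
Qed.

Lemma house_vec_unit : (house_vec A i)^T *m house_vec A i = 1%:M.
Proof.
rewrite [X in _ *m X]house_vecE -scalemxAr house_vec_dot scale_scalar_mx; congr _%:M.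
rewrite -house_beta_sqr expr2 -mulrA; congr (_ * (_ * _)).
rewrite !mxE !eqxx pE ltnSn mulr1 /house_den -/s -/p.
suff -> : \sum_(j < n.+1 | (i < j)%N)
   A j i * (shear_vec A i + s *: delta_mx p 0) j 0 = s ^+ 2 + A p i * s by ring.
rewrite house_s_sqr (bigD1 p) ?pE //= [in RHS](bigD1 p) ?pE //= !mxE !eqxx pE ltnSn.
rewrite mulr1 mulrDr -expr2 -!addrA; congr (_ + _); rewrite addrC; congr (_ + _).
apply: eq_bigr => j /andP[ij /negPf jp]; rewrite !mxE ij jp /=.
by rewrite mulr0 addr0 expr2.
Qed.

Lemma house_Q_orth : (house_Q A i)^T *m house_Q A i = 1%:M.
Proof.
rewrite house_Q_sym {2}/house_Q mulmxBr mulmx1 -scalemxAr mulmxA.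
have -> : house_Q A i *m house_vec A i = - house_vec A i.
  rewrite mulmxBl mul1mx -scalemxAl -mulmxA house_vec_unit mulmx1.
  by rewrite scaler_nat mulr2n opprD addNKr.
by rewrite mulNmx scalerN opprK /house_Q subrK.
Qed.

(** Since [w^T a_i = beta * den] and [2 beta^2 den = 1], the reflection subtracts
    [u + s e_(i+1)] from [a_i]; below row [i+1] this removes [a_i] itself. *)
Lemma house_reduces : supp_le i.+1 (house_Q A i *m col i A).
Proof.
move=> k ik; rewrite mulmxBl mul1mx -scalemxAl -mulmxA house_vec_dot_col.
rewrite mul_mx_scalar house_vecE !scalerA.
have -> : 2 * (house_beta A i * house_den A i) * house_beta A i = 1.
  by rewrite -[RHS]house_beta_sqr; ring.
by rewrite scale1r !mxE (ltnW ik) -val_eqE /= pE gtn_eqF //= mulr0 addr0 subrr.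
Qed.

End Householder.
End Step.

(** * One step of the reduction *)

Definition reduced_upto (R : rcfType) (n : nat) (S : 'M[R]_(n.+1 + n.+1))
    (k : nat) : Prop :=
  forall j : 'I_n.+1, (j < k)%N ->
    supp_le j.+1 (col j (ulsubmx S)) /\ supp_le j (col j (dlsubmx S)).

(** Column [i] gets reduced because the shear acts before the reflection, which
    then fixes the triangularized column; the earlier columns already have support
    where both factors act trivially. *)
Lemma step_reduces (R : rcfType) (n : nat) (S : 'M[R]_(n.+1 + n.+1))
    (i : 'I_n.+1) :
  (i < n)%N -> house_den (ulsubmx S) i != 0 ->
  upper_triangular_col (dlsubmx S) i \/
    shear_den (ulsubmx S) (dlsubmx S) i != 0 ->
  reduced_upto S i ->
  reduced_upto (invmx (step_mx S i) *m S *m step_mx S i) i.+1.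
Proof.
move=> lt_in den0 hY red j; rewrite ltnS => ji.
set Q := house_Q (ulsubmx S) i; set Y := shear_Y (ulsubmx S) (dlsubmx S) i.
have ei := @supp_le_delta R _ _ _ ji.
have [] := @shear_rot_conj R n.+1 Q Y S (delta_mx j 0) (house_Q_orth lt_in den0)
  (house_Q_supp _ ei) (shear_Y_supp _ _ ei).
rewrite -!colE /step_mx -/Q -/Y -/(shear_rot Q Y) => -> ->; rewrite house_Q_sym.
move: ji; rewrite leq_eqVlt => /orP[/eqP/val_inj ->|ji].
  have Ti := shear_triangularizes hY.
  by split; [exact: house_reduces | rewrite house_Q_supp].
have [Aj Tj] := red j ji.
have Ai : supp_le i (col j (ulsubmx S)) := supp_leW ji Aj.
have Ti : supp_le i (col j (dlsubmx S)) := supp_leW (ltnW ji) Tj.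
by rewrite shear_Y_supp // subr0 !house_Q_supp.
Qed.

(** * The accumulated transformation *)

(** The condition [Q e_0 = e_0] makes [Y e_0 = 0] stable under products, in which
    [Y] gets conjugated by the previous rotations. *)
Definition pointed_shear_rot (R : rcfType) (n : nat)
    (U : 'M[R]_(n.+1 + n.+1)) : Prop :=
  exists Q Y : 'M[R]_n.+1,
    [/\ U = shear_rot Q Y, Q^T *m Q = 1%:M, Y^T = Y,
        Q *m delta_mx 0 (0 : 'I_1) = delta_mx 0 0 &
        Y *m delta_mx 0 (0 : 'I_1) = 0].

Lemma pointed_shear_rot1 (R : rcfType) (n : nat) :
  pointed_shear_rot (1%:M : 'M[R]_(n.+1 + n.+1)).
Proof.
exists 1%:M, 0; rewrite /shear_rot mul0mx -scalar_mx_block trmx1 trmx0.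
by rewrite !mul1mx mul0mx.
Qed.

Lemma pointed_shear_rotM (R : rcfType) (n : nat) (U V : 'M[R]_(n.+1 + n.+1)) :
  pointed_shear_rot U -> pointed_shear_rot V -> pointed_shear_rot (U *m V).
Proof.
move=> [P [X [-> PP Xs Pe Xe]]] [Q [Y [-> QQ Ys Qe Ye]]].
exists (P *m Q), (X + P *m Y *m P^T); rewrite shear_rotM //; split => //.
- by rewrite trmx_mul mulmxA -(mulmxA _ P^T) PP mulmx1.
- by rewrite linearD /= !trmx_mul trmxK Xs Ys mulmxA.
- by rewrite -mulmxA Qe Pe.
- have Pte : P^T *m delta_mx 0 (0 : 'I_1) = delta_mx 0 0.
    by rewrite -{1}Pe mulmxA PP mul1mx.
  by rewrite mulmxDl Xe -mulmxA Pte -mulmxA Ye mulmx0 addr0.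
Qed.

Lemma step_pointed (R : rcfType) (n : nat) (S : 'M[R]_(n.+1 + n.+1))
    (i : 'I_n.+1) :
  (i < n)%N -> house_den (ulsubmx S) i != 0 -> pointed_shear_rot (step_mx S i).
Proof.
move=> lt_in den0; have e0 := @supp_le_delta R n.+1 i 0 (leq0n i).
exists (house_Q (ulsubmx S) i), (shear_Y (ulsubmx S) (dlsubmx S) i).
split=> //; [exact: house_Q_orth | exact: shear_Y_sym | exact: house_Q_supp |].
exact: shear_Y_supp.
Qed.

Lemma pointed_unit (R : rcfType) (n : nat) (U : 'M[R]_(n.+1 + n.+1)) :
  pointed_shear_rot U -> U \in unitmx.
Proof. by move=> [Q [Y [-> QQ _ _ _]]]; case: (mulmx1_unit (shear_rotV Y QQ)). Qed.

Definition partial_U (R : rcfType) (n : nat) (S : 'M[R]_(n.+1 + n.+1)) (k : nat) :=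
  \big[mulmx/1%:M]_(j < k) iter_U S j.

Lemma partial_US (R : rcfType) (n : nat) (S : 'M[R]_(n.+1 + n.+1)) (k : nat) :
  partial_U S k.+1 = partial_U S k *m iter_U S k.
Proof.
(* [mulmx] on these square matrices is the multiplication of a ring, whose monoid
   structure justifies splitting off the last factor. *)
exact: (@big_ord_recr _ 1 (@GRing.mul 'M[R]_(n.+1 + n.+1)) k (fun j => iter_U S j)).
Qed.

Theorem theorem2p2 (R : rcfType) (n : nat) (S : 'M[R]_(n.+1 + n.+1))
  (hbeta : forall k : nat, (k < n)%N ->
     house_den (ulsubmx (iter_S S k)) (inord k) != 0)
  (hY : forall k : nat, (k < n)%N ->
     upper_triangular_col (dlsubmx (iter_S S k)) (inord k) \/
     shear_den (ulsubmx (iter_S S k)) (dlsubmx (iter_S S k)) (inord k) != 0) :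
  (exists Q Y : 'M[R]_n.+1,
     [/\ global_U S = block_mx Q 0 (Y *m Q) Q,
         Q^T *m Q = 1%:M,
         Y^T = Y,
         row 0 Y = 0 &
         col 0 Y = 0]) /\
  (let S' := invmx (global_U S) *m S *m global_U S in
   upper_hessenberg (ulsubmx S') /\ upper_triangular (dlsubmx S')).
Proof.
have inv k : (k <= n)%N ->
  [/\ pointed_shear_rot (partial_U S k),
      iter_S S k = invmx (partial_U S k) *m S *m partial_U S k &
      reduced_upto (iter_S S k) k].
  elim: k => [_|k IH lt_kn].
    rewrite /partial_U big_ord0; split=> //; first exact: pointed_shear_rot1.
    by rewrite invmx1 mul1mx mulmx1.
  have [pU Sk red] := IH (ltnW lt_kn).
  have kE : (inord k : 'I_n.+1) = k :> nat by rewrite inordK // ltnW.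
  have lt_k : ((inord k : 'I_n.+1) < n)%N by rewrite kE.
  have pk : pointed_shear_rot (iter_U S k) by apply: step_pointed => //; exact: hbeta.
  rewrite partial_US; split; first exact: pointed_shear_rotM.
    by rewrite invmxM ?pointed_unit //= {2}Sk /iter_U !mulmxA.
  rewrite -{2}kE; apply: step_reduces; rewrite ?kE //; [exact: hbeta | exact: hY].
have [[Q [Y [UE QQ Ys _ Ye]]] Sn red] := inv n (leqnn n).
split.
  exists Q, Y; split=> //; last by rewrite colE.
  by rewrite -Ys -tr_col colE Ye trmx0.
move=> S'; have redS' : reduced_upto S' n by rewrite /S' /global_U -/(partial_U S n) -Sn.
(* The last column, never treated, has no row below its diagonal. *)
split; apply/forallP => j.
  apply/hessenberg_colP; have [/redS'[] //|nj k jk] := ltnP j n.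
  by have := leq_trans (ltn_ord k) (leq_ltn_trans nj (ltnW jk)); rewrite ltnn.
apply/upper_triangular_colP; have [/redS'[] //|nj k jk] := ltnP j n.
by have := leq_trans (ltn_ord k) (leq_ltn_trans nj jk); rewrite ltnn.
Qed.
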